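(* Let $\pi^*=\arg\max_\pi \mathcal{G}(\pi)$ be the optimal policy for the KL-regularized objective $$\mathcal{G}(\pi)=\mathbb{E}_{x\sim\rho}\Big[\mathbb{E}_{y\sim\pi(\cdot|x)}[r(x,y)]-\beta\,\mathbb{KL}\big(\pi(\cdot|x),\pi_{\mathrm{ref}}(\cdot|x)\big)\Big].$$ Then for any generation $y$, the following quantity computed per $(x,y)$, $$r(x,y)-\beta\log\frac{\pi^*(y|x)}{\pi_{\mathrm{ref}}(y|x)},$$ does not depend on $y$. It is a function of the prompt $x$ only.
   Context: $\mathcal{X}$ is the space of prompts and $\mathcal{Y}$ the space of responses (also called generations). $\rho$ is a sampling distribution over prompts in $\mathcal{X}$. $r(x,y)$ is a real-valued reward function of a prompt $x\in\mathcal{X}$ and a response $y\in\mathcal{Y}$. A policy $\pi$ assigns to each prompt $x$ a probability distribution $\pi(\cdot|x)$ over $\mathcal{Y}$; $\pi_{\mathrm{ref}}$ is a fixed reference policy. The coefficient $\beta\ge 0$ determines the trade-off between reward maximization and regularization. The KL divergence is $\mathbb{KL}(\pi(\cdot|x),\pi_{\mathrm{ref}}(\cdot|x))=\mathbb{E}_{y\sim\pi(\cdot|x)}\big[\log\frac{\pi(y|x)}{\pi_{\mathrm{ref}}(y|x)}\big]$.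
   Formalization: The claim is proved for almost every prompt x under the sampling distribution and almost every y with π_ref(y|x)>0 (every such y if responses are countable); if β=0 only for y with π*(y|x)>0, since it fails otherwise; the optimal value of G is assumed finite. *)

(* Defs.v *)
(* MathComp-Analysis. *)
From HB Require Import structures.
From mathcomp Require Import all_boot all_order all_algebra.
From mathcomp Require Import all_classical all_reals all_analysis.

Set Implicit Arguments.
Unset Strict Implicit.
Unset Printing Implicit Defensive.

Import Order.TTheory GRing.Theory Num.Theory.
Import numFieldNormedType.Exports.

Local Open Scope classical_set_scope.
Local Open Scope ring_scope.
Local Open Scope ereal_scope.

(* The number pi(y|x) is [pi x y], the density of pi(.|x) at y with respect to
   a sigma-finite measure [mu] on responses. For countably many responses and
   the counting measure it is the probability of y given x, and "mu-almost
   every y" means "every y". *)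
Definition is_policy (R : realType) (d1 d2 : measure_display)
    (X : measurableType d1) (Y : measurableType d2)
    (mu : {sigma_finite_measure set Y -> \bar R}) (pi : X -> Y -> R) : Prop :=
  [/\ measurable_fun [set: X * Y] (fun z => pi z.1 z.2),
      forall x y, (0 <= pi x y)%R &
      forall x, \int[mu]_y (pi x y)%:E = 1].

Definition response_expectation (R : realType) (d1 d2 : measure_display)
    (X : measurableType d1) (Y : measurableType d2)
    (mu : {sigma_finite_measure set Y -> \bar R}) (pi : X -> Y -> R)
    (x : X) (g : Y -> \bar R) : \bar R :=
  \int[mu]_y ((pi x y)%:E * g y).

(* Quotient and logarithm are those of the extended reals: for p, q >= 0 the
   value is +oo if p > 0 = q, and -oo if p = 0. As 0 * (-oo) = 0, responses
   with pi(y|x) = 0 do not contribute to the KL divergence, and the divergence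
   is +oo when pi(.|x) is not absolutely continuous with respect to
   pi_ref(.|x). *)
Definition log_ratio (R : realType) (p q : R) : \bar R :=
  lne (p%:E / q%:E).

Definition KL (R : realType) (d1 d2 : measure_display)
    (X : measurableType d1) (Y : measurableType d2)
    (mu : {sigma_finite_measure set Y -> \bar R}) (pi pi_ref : X -> Y -> R)
    (x : X) : \bar R :=
  response_expectation mu pi x (fun y => log_ratio (pi x y) (pi_ref x y)).

(* Undefined expressions (+oo) - (+oo), in the expectations or in the
   difference, evaluate to -oo, so a policy at which the objective is
   undefined never competes for the maximum. *)
Definition objective (R : realType) (d1 d2 : measure_display)
    (X : measurableType d1) (Y : measurableType d2)
    (mu : {sigma_finite_measure set Y -> \bar R}) (rho : probability X R)
    (r : X -> Y -> R) (beta : R) (pi_ref pi : X -> Y -> R) : \bar R :=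
  \int[rho]_x (response_expectation mu pi x (fun y => (r x y)%:E)
               - beta%:E * KL mu pi pi_ref x).

Definition is_optimal_policy (R : realType) (d1 d2 : measure_display)
    (X : measurableType d1) (Y : measurableType d2)
    (mu : {sigma_finite_measure set Y -> \bar R}) (rho : probability X R)
    (r : X -> Y -> R) (beta : R) (pi_ref pi_star : X -> Y -> R) : Prop :=
  is_policy mu pi_star /\
  forall pi : X -> Y -> R, is_policy mu pi ->
    objective mu rho r beta pi_ref pi <= objective mu rho r beta pi_ref pi_star.

(* Main.v *)
(* Write f(x,y) for r - beta log(pi_star/pi_ref).  If f(x,.) took values below s
   and values above t > s on sets T_x and S_x of positive measure, for a
   non-null set of prompts x, then moving the mass eps mu(S_x) mu(T_x) from T_x
   to S_x at every prompt would be a policy with a larger objective: the payoff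
   is concave in pi(y|x) and f - beta is its derivative.  So mu(S_x) mu(T_x) = 0
   for almost every x.  To have finite measures and a uniform eps, S and T are
   cut down to where pi_ref, r and pi_star are controlled by a bound M; letting
   M run over the integers and s < t over the rationals gives that f(x,.) is
   almost everywhere constant.  The constant is finite, since f = +oo means
   pi_star = 0, which cannot hold almost everywhere on {pi_ref > 0}. *)
Require Import Defs.
From HB Require Import structures.
From mathcomp Require Import all_boot all_order all_algebra.
From mathcomp Require Import all_classical all_reals all_analysis.
From mathcomp Require Import measurable_realfun ring lra.
Set Implicit Arguments.
Unset Strict Implicit.
Unset Printing Implicit Defensive.

Import Order.TTheory GRing.Theory Num.Theory.
Import numFieldNormedType.Exports.
Local Open Scope classical_set_scope.
Local Open Scope ring_scope.
Local Open Scope ereal_scope.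

Lemma log_ratioE (R : realType) (p q : R) : (0 <= p)%R -> (0 <= q)%R ->
  log_ratio p q =
  if p == 0%R then -oo else if q == 0%R then +oo else (ln p - ln q)%:E.
Proof.
move=> p0 q0; rewrite /log_ratio inver.
have [->|pn0] := eqVneq p 0%R; first by rewrite mul0e /= lexx.
have pp : (0 < p)%R by rewrite lt_def pn0.
have [_|qn0] := eqVneq q 0%R; first by rewrite gt0_muley ?lte_fin.
have qp : (0 < q)%R by rewrite lt_def qn0.
by rewrite -EFinM lne_EFin ?divr_gt0// ln_div.
Qed.

Lemma ln_le_tangent (R : realType) (x y : R) : (0 < x)%R -> (0 < y)%R ->
  (ln y - ln x <= (y - x) / x)%R.
Proof.
move=> x0 y0; rewrite -ln_div ?posrE//.
have -> : (y / x = 1 + (y - x) / x)%R by field; rewrite gt_eqF.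
apply: le_ln1Dx; rewrite ltr_pdivlMr// mulN1r; lra.
Qed.

Definition payoff (R : realType) (beta r v p : R) : R :=
  (p * r - beta * (p * (ln p - ln v)))%R.

Section payoff.
Context {R : realType}.
Implicit Types beta r v p q k M t s d : R.
Local Open Scope ring_scope.

Lemma payoff_tangent beta r v p q : 0 <= beta -> 0 <= p -> 0 < q ->
  (q - p) * (r - beta * (ln q - ln v) - beta) <=
  payoff beta r v q - payoff beta r v p.
Proof.
move=> b0 p0 q0; rewrite /payoff.
suff : 0 <= beta * (q - p - p * (ln q - ln p)) by lra.
rewrite mulr_ge0//; move: p0; rewrite le_eqVlt => /predU1P[<-|p0]; first lra.
have := ln_le_tangent p0 q0; rewrite ler_pdivlMr//; lra.
Qed.

Lemma payoff_increase beta r v p k M t d :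
  0 <= beta -> 1 <= M -> M^-1 <= v -> `|r| <= M -> 0 <= k -> k * M <= d ->
  (M^-1 <= p /\ t < r - beta * (ln p - ln v)) \/
    [/\ p = 0, 0 < beta & beta * ln d <= - (M + t)] -> 0 < d ->
  k * (t - beta * d - beta) <= payoff beta r v (p + k) - payoff beta r v p.
Proof.
move=> b0 M1 vM; rewrite ler_norml => /andP[r1 r2] k0 kM pP d0.
have M0 : 0 < M by lra.
have v0 : 0 < v by apply: lt_le_trans vM; rewrite invr_gt0.
move: k0; rewrite le_eqVlt => /predU1P[<-|k0]; first by rewrite addr0; lra.
have p0 : 0 <= p.
  by case: pP => [[/(le_trans _)->//]|[->//]]; rewrite invr_ge0 ltW.
apply: le_trans (payoff_tangent r v b0 p0 _); last lra.
have -> : p + k - p = k by ring.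
rewrite ler_pM2l// lerD2r.
case: pP => [[pM tp]|[-> bp ed]].
  have pp : 0 < p by apply: lt_le_trans pM; rewrite invr_gt0.
  have := ln_le_tangent pp (_ : 0 < p + k).
  have -> : p + k - p = k by ring.
  move=> /(_ _)H; have {}H : ln (p + k) - ln p <= k / p by apply: H; lra.
  have : k / p <= d.
    rewrite ler_pdivrMr// (le_trans (_ : _ <= d / M))//.
      by rewrite ler_pdivlMr.
    by rewrite ler_pM2l.
  move=> kp; have : ln (p + k) - ln p <= d by lra.
  move=> /(ler_wpM2l b0); lra.
rewrite add0r.
have : ln k + ln M <= ln d.
  by rewrite -lnM ?posrE// ler_ln ?posrE// mulr_gt0.
have : - ln M <= ln v.
  by rewrite -lnV ?posrE// ler_ln ?posrE ?invr_gt0.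
move=> lv lk; have : ln k - ln v <= ln d by lra.
move=> /(ler_wpM2l b0).
have : 0 <= beta * d by rewrite mulr_ge0// ltW.
lra.
Qed.

Lemma payoff_decrease beta r v p k M s d :
  0 <= beta -> 1 <= M -> 0 <= k -> k * M <= d -> d <= 2^-1 ->
  M^-1 <= p -> r - beta * (ln p - ln v) < s ->
  - k * (s + 2 * (beta * d) - beta) <=
  payoff beta r v (p - k) - payoff beta r v p.
Proof.
move=> b0 M1 k0 kM d2 pM ps.
have M0 : 0 < M by lra.
have d0 : 0 <= d by apply: le_trans kM; rewrite mulr_ge0// ltW.
have pp : 0 < p by apply: lt_le_trans pM; rewrite invr_gt0.
have pM1 : 1 <= p * M by rewrite -ler_pdivrMr// div1r.
have kp : 2^-1 <= (p - k) * M by lra.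
have pk : 0 < p - k by rewrite -(pmulr_lgt0 _ M0); lra.
apply: le_trans (payoff_tangent r v b0 (ltW pp) pk).
have -> : p - k - p = - k by ring.
rewrite !mulNr lerN2 ler_wpM2l// lerD2r.
have := ln_le_tangent pk pp.
have -> : p - (p - k) = k by ring.
have : k / (p - k) <= 2 * d.
  rewrite ler_pdivrMr//.
  rewrite -(ler_pM2r M0) (le_trans kM)// -mulrA.
  have := ler_wpM2l d0 kp; lra.
move=> kd lk; have : ln p - ln (p - k) <= 2 * d by lra.
move=> /(ler_wpM2l b0); lra.
Qed.

Lemma entropy_bound M u v : 0 < M -> 0 <= u <= M + 1 -> M^-1 <= v <= M ->
  `|u * (ln u - ln v)| <= (M + 1) ^+ 2 * M + M.
Proof.
move=> M0 /andP[u0 uM] /andP[vM1 vM].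
have v0 : 0 < v by apply: lt_le_trans vM1; rewrite invr_gt0.
have MM : 0 <= (M + 1) ^+ 2 * M by rewrite mulr_ge0 ?sqr_ge0 ?ltW.
move: u0; rewrite le_eqVlt => /predU1P[<-|u0]; first by rewrite mul0r normr0; lra.
rewrite ler_norml; apply/andP; split.
  have := ln_le_tangent u0 v0; rewrite ler_pdivlMr//; lra.
have H := ln_le_tangent v0 u0.
have vi : v^-1 <= M by rewrite invf_ple ?posrE.
have : (u - v) / v <= (M + 1) * M.
  have -> : (u - v) / v = u * v^-1 - 1 by field; rewrite gt_eqF.
  have : u * v^-1 <= (M + 1) * M by apply: ler_pM => //; rewrite ?invr_ge0 ltW.
  lra.
move=> H2; have H3 : ln u - ln v <= (M + 1) * M by lra.
have := ler_wpM2l (ltW u0) H3.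
have : u * ((M + 1) * M) <= (M + 1) * ((M + 1) * M).
  by rewrite ler_wpM2r// mulr_ge0 ?ltW//; lra.
rewrite expr2; lra.
Qed.

End payoff.

Lemma ae_le_integral d (T : measurableType d) (R : realType)
    (mu : {measure set T -> \bar R}) (f g : T -> \bar R) :
  measurable_fun setT f -> measurable_fun setT g ->
  {ae mu, forall x, f x <= g x} -> \int[mu]_x f x <= \int[mu]_x g x.
Proof.
move=> mf mg fg; rewrite integralE [leRHS]integralE; apply: leeB.
  apply: ae_ge0_le_integral => //; try exact: measurable_funepos.
  by apply: filterS fg => x fgx _; rewrite !funeposE ge_max !le_max fgx lexx orbT.
apply: ae_ge0_le_integral => //; try exact: measurable_funeneg.
apply: filterS fg => x fgx _.
by rewrite !funenegE ge_max !le_max leeN2 fgx lexx orbT.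
Qed.

Lemma fin_num_integrable d (T : measurableType d) (R : realType)
    (mu : {measure set T -> \bar R}) (f : T -> \bar R) :
  measurable_fun setT f -> \int[mu]_x f x \is a fin_num ->
  mu.-integrable setT f.
Proof.
move=> mf; rewrite fin_num_abs => /(abse_integralP mu measurableT mf) fi.
exact/integrableP.
Qed.

Lemma measurable_integral_section d1 d2 (X : measurableType d1)
    (Y : measurableType d2) (R : realType)
    (mu : {sigma_finite_measure set Y -> \bar R}) (f : X * Y -> \bar R) :
  measurable_fun setT f -> measurable_fun setT (fun x => \int[mu]_y f (x, y)).
Proof.
move=> mf.
have -> : (fun x => \int[mu]_y f (x, y)) =
    fubini_F mu f^\+ \- fubini_F mu f^\-.
  apply/funext => x; rewrite integralE /=.
  by congr (_ - _); apply: eq_integral => y _; rewrite ?funeposE ?funenegE.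
apply: emeasurable_funB; apply: measurable_fun_fubini_tonelli_F.
- exact: measurable_funepos.
- by move=> x; exact: funepos_ge0.
- exact: measurable_funeneg.
- by move=> x; exact: funeneg_ge0.
Qed.

Lemma markov_density d (T : measurableType d) (R : realType)
    (mu : {measure set T -> \bar R}) (v : T -> R) (M : R) (B : set T) :
  measurable_fun setT v -> (forall y, 0 <= v y)%R -> \int[mu]_y (v y)%:E = 1 ->
  (0 < M)%R -> measurable B -> (forall y, B y -> M^-1 <= v y)%R ->
  mu B <= M%:E.
Proof.
move=> mv v0 v1 M0 mB Bv.
have : \int[mu]_y (M^-1 * \1_B y)%:E <= \int[mu]_y (v y)%:E.
  apply: ge0_le_integral => //.
  - by move=> y _; rewrite lee_fin mulr_ge0// invr_ge0 ltW.
  - apply/measurable_EFinP; apply: measurable_funM.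
      exact: measurable_cst.
    exact: measurable_indic.
  - exact/measurable_EFinP.
  - move=> y _; rewrite lee_fin indicE; case: (boolP (y \in B)) => /= yB.
      by rewrite mulr1 Bv//; exact/set_mem.
    by rewrite mulr0.
under eq_integral do rewrite EFinM.
rewrite ge0_integralZl_EFin//; last by rewrite invr_ge0 ltW.
  by rewrite integral_indic// setIT v1 lee_pdivrMl// mule1.
by apply/measurable_EFinP; exact: measurable_indic.
Qed.

Lemma measurable_log_ratio d (T : measurableType d) (R : realType)
    (p q : T -> R) :
  measurable_fun setT p -> measurable_fun setT q ->
  (forall y, 0 <= p y)%R -> (forall y, 0 <= q y)%R ->
  measurable_fun setT (fun y => log_ratio (p y) (q y)).
Proof.
move=> mp mq p0 q0.
under eq_fun do rewrite log_ratioE//.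
apply: measurable_fun_ifT => //; first exact: measurable_fun_eqr.
apply: measurable_fun_ifT => //; first exact: measurable_fun_eqr.
apply/measurable_EFinP; apply: measurable_funB; apply: measurableT_comp => //;
  exact: measurable_ln.
Qed.

Section score.
Context d1 d2 (X : measurableType d1) (Y : measurableType d2) (R : realType).
Variable mu : {sigma_finite_measure set Y -> \bar R}.
Variables (r ref : X -> Y -> R) (beta : R).

Definition score (pi : X -> Y -> R) (x : X) : \bar R :=
  response_expectation mu pi x (fun y => (r x y)%:E) - beta%:E * KL mu pi ref x.

Hypothesis mr : measurable_fun [set: X * Y] (fun z => r z.1 z.2).
Hypothesis refP : is_policy mu ref.

Lemma measurable_section (f : X -> Y -> R) (x : X) :
  measurable_fun [set: X * Y] (fun z => f z.1 z.2) -> measurable_fun setT (f x).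
Proof.
move=> mf; exact: (measurableT_comp mf (pair1_measurable x)).
Qed.

Lemma measurable_score pi : is_policy mu pi -> measurable_fun setT (score pi).
Proof.
case: refP => mref ref0 _ [mpi pi0 _].
apply: emeasurable_funB.
  apply: (@measurable_integral_section _ _ _ _ _ mu
    (fun z => (pi z.1 z.2)%:E * (r z.1 z.2)%:E)).
  by apply: emeasurable_funM; exact/measurable_EFinP.
apply: emeasurable_funM => //.
apply: (@measurable_integral_section _ _ _ _ _ mu
  (fun z => (pi z.1 z.2)%:E * log_ratio (pi z.1 z.2) (ref z.1 z.2))).
apply: emeasurable_funM; first exact/measurable_EFinP.
exact: measurable_log_ratio.
Qed.

Lemma KL_fin_num pi (x : X) : score pi x \is a fin_num -> beta != 0%R ->
  KL mu pi ref x \is a fin_num.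
Proof.
rewrite fin_numB => /andP[_ +] bn0.
by case: (KL mu pi ref x) => //; rewrite mulr_infty;
  case: sgrP bn0 => //=; rewrite ?mul1e ?mulN1e.
Qed.

(* The KL terms may be infinite when [beta = 0]; they are then multiplied by 0. *)
Lemma scoreD pi q (x : X) (B : set Y) (C : R) :
  is_policy mu pi -> is_policy mu q -> measurable B -> mu B < +oo ->
  (forall y, ~ B y -> q x y = pi x y) -> (forall y, B y -> 0 < ref x y)%R ->
  (forall y, B y -> `|(q x y - pi x y) * r x y| <= C)%R ->
  (forall y, B y -> `|pi x y * (ln (pi x y) - ln (ref x y))| <= C)%R ->
  (forall y, B y -> `|q x y * (ln (q x y) - ln (ref x y))| <= C)%R ->
  score pi x \is a fin_num ->
  let g y := (payoff beta (r x y) (ref x y) (q x y) -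
              payoff beta (r x y) (ref x y) (pi x y))%R in
  mu.-integrable setT (EFin \o g) /\
  score q x = score pi x + \int[mu]_y (g y)%:E.
Proof.
case: refP => mref' ref0 _ [mpi' pi0 _] [mq' q0 _] mB Boo qB refB Cr Cp Cq.
have mrx := measurable_section x mr.
have mref := measurable_section x mref'.
have mpi := measurable_section x mpi'.
have mq := measurable_section x mq'.
move=> sfin g; move: (sfin); rewrite /score fin_numB => /andP[Afin _].
have iB : mu.-integrable setT (fun y => (C + C)%:E * (\1_B y)%:E).
  apply: integrableZl => //; apply/integrableP; split.
    by apply/measurable_EFinP; exact: measurable_indic.
  under eq_integral do rewrite gee0_abs ?lee_fin//.
  by rewrite integral_indic// setIT.
have iBd (f : Y -> R) : measurable_fun setT f ->
    (forall y, ~ B y -> f y = 0%R) -> (forall y, B y -> `|f y| <= C + C)%R ->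
    mu.-integrable setT (EFin \o f).
  move=> mf f0 fC; apply: le_integrable iB => //.
    exact/measurable_EFinP.
  move=> y _ /=; rewrite lee_fin indicE.
  have [yB|yB] := pselect (B y).
    by rewrite mem_set// mulr1 (le_trans (fC _ yB))// ler_norm.
  by rewrite memNset// f0// mulr0 normr0.
pose gr y := ((q x y - pi x y) * r x y)%R.
pose gk y := (q x y * (ln (q x y) - ln (ref x y)) -
              pi x y * (ln (pi x y) - ln (ref x y)))%R.
have mpln (p : Y -> R) : measurable_fun setT p ->
    measurable_fun setT (fun y => p y * (ln (p y) - ln (ref x y)))%R.
  move=> mp; apply: measurable_funM => //.
  by apply: measurable_funB; apply: measurableT_comp => //; exact: measurable_ln.
have igr : mu.-integrable setT (EFin \o gr).
  apply: iBd.
  - by apply: measurable_funM => //; exact: measurable_funB.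
  - by move=> y /qB; rewrite /gr => ->; rewrite subrr mul0r.
  - move=> y yB; have := Cr _ yB; rewrite -/(gr y).
    have := normr_ge0 (gr y); lra.
have igk : mu.-integrable setT (EFin \o gk).
  apply: iBd.
  - by apply: measurable_funB; exact: mpln.
  - by move=> y /qB; rewrite /gk => ->; rewrite subrr.
  - by move=> y yB; rewrite (le_trans (ler_normB _ _))// lerD ?Cq ?Cp.
have gE y : (g y)%:E = (gr y)%:E + (- beta)%:E * (gk y)%:E.
  by rewrite -EFinM -EFinD; congr EFin; rewrite /g /gr /gk /payoff; ring.
have ig' : mu.-integrable setT (fun y => (- beta)%:E * (gk y)%:E).
  exact: integrableZl.
have ig : mu.-integrable setT (EFin \o g).
  rewrite (_ : EFin \o g = (EFin \o gr) \+ (fun y => (- beta)%:E * (gk y)%:E)).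
    exact: integrableD.
  by apply/funext => y; exact: gE.
split=> //.
have Aq : response_expectation mu q x (fun y => (r x y)%:E) =
    response_expectation mu pi x (fun y => (r x y)%:E) + \int[mu]_y (gr y)%:E.
  rewrite /response_expectation -integralD//.
    apply: eq_integral => y _; rewrite -!EFinM -EFinD; congr EFin.
    by rewrite /gr; ring.
  apply: fin_num_integrable => //.
  by apply: emeasurable_funM; exact/measurable_EFinP.
have Kq : beta%:E * KL mu q ref x =
    beta%:E * KL mu pi ref x + beta%:E * \int[mu]_y (gk y)%:E.
  have [->|bn0] := eqVneq beta 0%R; first by rewrite !mul0e adde0.
  have Kpi := KL_fin_num sfin bn0.
  rewrite -muleDr//; last by rewrite fin_num_adde_defr.
  congr (_ * _); rewrite /KL /response_expectation -integralD//.
    apply: eq_integral => y _; have [yB|yB] := pselect (B y); last first.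
      by rewrite /gk qB// subrr adde0.
    have rn0 : ref x y != 0%R by rewrite gt_eqF// refB.
    have E (p : Y -> R) : (0 <= p y)%R -> (p y)%:E * log_ratio (p y) (ref x y) =
        (p y * (ln (p y) - ln (ref x y)))%:E.
      move=> p0; rewrite log_ratioE// (negbTE rn0).
      by have [->|] := eqVneq (p y) 0%R; rewrite ?mul0e ?mul0r// EFinM.
    by rewrite !E// -EFinD; congr EFin; rewrite /gk; ring.
  apply: fin_num_integrable => //.
  apply: emeasurable_funM; first exact/measurable_EFinP.
  exact: measurable_log_ratio.
rewrite Aq Kq.
under [X in _ = _ + X]eq_integral do rewrite gE.
rewrite integralD// integralZl//.
have fr := integrable_fin_num measurableT igr.
have fk := integrable_fin_num measurableT igk.
rewrite EFinN mulNe oppeD ?fin_num_adde_defl// ?fin_numM//.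
by rewrite addeACA.
Qed.

End score.

Lemma small_step (R : realType) (beta M s t : R) : (0 <= beta)%R -> (s < t)%R ->
  exists d : R, [/\ 0 < d, d <= 2^-1, 3 * (beta * d) < t - s &
    0 < beta -> beta * ln d <= - (M + t)]%R.
Proof.
move=> b0 st.
have g0 : (0 < (t - s) / (4 * (beta + 1)))%R by apply: divr_gt0; lra.
exists (Num.min 2^-1
  (Num.min ((t - s) / (4 * (beta + 1))) (expR (- (M + t) / beta))))%R.
set d := Num.min _ _.
have d0 : (0 < d)%R by rewrite !lt_min g0 expR_gt0 invr_gt0; lra.
split => //.
- by rewrite ge_min lexx.
- have : (d <= (t - s) / (4 * (beta + 1)))%R by rewrite !ge_min lexx orbT.
  rewrite ler_pdivlMr; lra.
- move=> bp; rewrite mulrC -ler_pdivlMr// -[leRHS]expRK ler_ln ?posrE ?expR_gt0//.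
  by rewrite !ge_min lexx !orbT.
Qed.

Lemma integral_indicB d (T : measurableType d) (R : realType)
    (mu : {measure set T -> \bar R}) (A B : set T) (a b : R) :
  measurable A -> measurable B -> mu A < +oo -> mu B < +oo ->
  let f y := (a * \1_A y - b * \1_B y)%R in
  mu.-integrable setT (EFin \o f) /\
  \int[mu]_y (f y)%:E = (a * fine (mu A) - b * fine (mu B))%:E.
Proof.
move=> mA mB Aoo Boo f.
have ind (D : set T) (c : R) : measurable D -> mu D < +oo ->
    mu.-integrable setT (fun y => c%:E * (\1_D y)%:E) /\
    \int[mu]_y (c%:E * (\1_D y)%:E) = (c * fine (mu D))%:E.
  move=> mD Doo.
  have iD : mu.-integrable setT (fun y => (\1_D y)%:E).
    apply/integrableP; split.
      by apply/measurable_EFinP; exact: measurable_indic.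
    under eq_integral do rewrite gee0_abs ?lee_fin//.
    by rewrite integral_indic// setIT.
  split; first exact: integrableZl.
  by rewrite integralZl// integral_indic// setIT EFinM fineK// ge0_fin_numE.
have [iA EA] := ind _ a mA Aoo; have [iB EB] := ind _ b mB Boo.
have -> : EFin \o f =
    (fun y => a%:E * (\1_A y)%:E) \- (fun y => b%:E * (\1_B y)%:E).
  by apply/funext => y.
split; first exact: integrableB.
by rewrite EFinB -EA -EB -integralB.
Qed.

Section perturbation.
Context d1 d2 (X : measurableType d1) (Y : measurableType d2) (R : realType).
Variable mu : {sigma_finite_measure set Y -> \bar R}.
Variables (r ref pi : X -> Y -> R) (beta : R).
Hypothesis mr : measurable_fun [set: X * Y] (fun z => r z.1 z.2).
Hypothesis beta_ge0 : (0 <= beta)%R.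
Hypothesis refP : is_policy mu ref.
Hypothesis piP : is_policy mu pi.
Implicit Types (x : X) (y : Y) (z : X * Y).

Definition implicit_reward x y : R :=
  (r x y - beta * (ln (pi x y) - ln (ref x y)))%R.

Definition low (M s : R) : set (X * Y) := [set z |
  [&& M^-1 <= ref z.1 z.2, ref z.1 z.2 <= M, `|r z.1 z.2| <= M,
      M^-1 <= pi z.1 z.2, pi z.1 z.2 <= M & implicit_reward z.1 z.2 < s]%R].

(* Where [pi] vanishes and [0 < beta], the derivative of the entropy makes the
   reward of adding mass infinite, so no condition on [t] is imposed there. *)
Definition high (M t : R) : set (X * Y) := [set z |
  [&& M^-1 <= ref z.1 z.2, ref z.1 z.2 <= M, `|r z.1 z.2| <= M &
      [&& M^-1 <= pi z.1 z.2, pi z.1 z.2 <= M & t < implicit_reward z.1 z.2]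
      || ((pi z.1 z.2 == 0) && (0 < beta))]%R].

Let mref : measurable_fun setT (fun z => ref z.1 z.2).
Proof. by case: refP. Qed.

Let mpi : measurable_fun setT (fun z => pi z.1 z.2).
Proof. by case: piP. Qed.

Let mimplicit : measurable_fun setT (fun z => implicit_reward z.1 z.2).
Proof.
apply: measurable_funB => //; apply: measurable_funM => //.
by apply: measurable_funB; apply: measurableT_comp => //; exact: measurable_ln.
Qed.

Let measurable_pred (P : X * Y -> bool) :
  measurable_fun setT P -> measurable [set z | P z].
Proof.
move=> mP; have -> : [set z | P z] = setT `&` P @^-1` [set true].
  by rewrite setTI; apply/seteqP; split => z.
exact: mP.
Qed.

Lemma measurable_low M s : measurable (low M s).
Proof.
apply: measurable_pred.
by repeat first [apply: measurable_and | apply: measurable_fun_ler |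
  apply: measurable_fun_ltr | apply: measurableT_comp] => //.
Qed.

Lemma measurable_high M t : measurable (high M t).
Proof.
apply: measurable_pred.
by repeat first [apply: measurable_and | apply: measurable_or |
  apply: measurable_fun_ler | apply: measurable_fun_eqr |
  apply: measurable_fun_ltr | apply: measurableT_comp] => //.
Qed.

Lemma low_high_disjoint M s t z : (0 < M)%R -> (s < t)%R ->
  low M s z -> high M t z -> False.
Proof.
move=> M0 st /and5P[_ _ _ pM /andP[_ ps]] /and4P[_ _ _ /orP[/and3P[_ _ tp]|/andP[/eqP p0 _]]].
  by have := lt_trans (lt_trans ps st) tp; rewrite ltxx.
by move: pM; rewrite p0 leNgt invr_gt0 M0.
Qed.

Lemma mu_xsection_le (A : set (X * Y)) M x : (0 < M)%R -> measurable A ->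
  (forall z, A z -> M^-1 <= ref z.1 z.2)%R -> mu (xsection A x) <= M%:E.
Proof.
move=> M0 mA Aref; have [_ ref0 ref1] := refP.
apply: (@markov_density _ _ _ mu (ref x)) => //.
- exact: measurable_section.
- exact: measurable_xsection.
- by move=> y /xsectionP/Aref.
Qed.

Section swap.
Variables (M s t e d : R).
Hypotheses (M1 : (1 <= M)%R) (st : (s < t)%R).
Hypotheses (d0 : (0 < d)%R) (d_half : (d <= 2^-1)%R).
Hypothesis dhigh : (0 < beta -> beta * ln d <= - (M + t))%R.
Hypotheses (e0 : (0 < e)%R) (eM : (e * M * M = d)%R).

Let a x := fine (mu (xsection (low M s) x)).
Let b x := fine (mu (xsection (high M t) x)).

Let M0 : (0 < M)%R. Proof. exact: lt_le_trans ltr01 M1. Qed.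

Let mu_low x : mu (xsection (low M s) x) <= M%:E.
Proof.
apply: mu_xsection_le => //; first exact: measurable_low.
by move=> z /and5P[].
Qed.

Let mu_high x : mu (xsection (high M t) x) <= M%:E.
Proof.
apply: mu_xsection_le => //; first exact: measurable_high.
by move=> z /and4P[].
Qed.

Let aE x : (a x)%:E = mu (xsection (low M s) x).
Proof. by rewrite fineK// ge0_fin_numE// (le_lt_trans (mu_low x)) ?ltry. Qed.

Let bE x : (b x)%:E = mu (xsection (high M t) x).
Proof. by rewrite fineK// ge0_fin_numE// (le_lt_trans (mu_high x)) ?ltry. Qed.

Let a_ge0 x : (0 <= a x)%R. Proof. by rewrite fine_ge0. Qed.
Let b_ge0 x : (0 <= b x)%R. Proof. by rewrite fine_ge0. Qed.

Let eaM x : (e * a x * M <= d)%R.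
Proof.
by rewrite -eM -!mulrA ler_wpM2l ?(ltW e0)// ler_wpM2r ?(ltW M0)// -lee_fin aE.
Qed.

Let ebM x : (e * b x * M <= d)%R.
Proof.
by rewrite -eM -!mulrA ler_wpM2l ?(ltW e0)// ler_wpM2r ?(ltW M0)// -lee_fin bE.
Qed.

Let ea_ge0 x : (0 <= e * a x)%R. Proof. by rewrite mulr_ge0// ltW. Qed.
Let eb_ge0 x : (0 <= e * b x)%R. Proof. by rewrite mulr_ge0// ltW. Qed.

Let ma : measurable_fun setT a.
Proof.
apply: measurableT_comp => //; apply: measurable_fun_xsection.
exact: measurable_low.
Qed.

Let mb : measurable_fun setT b.
Proof.
apply: measurableT_comp => //; apply: measurable_fun_xsection.
exact: measurable_high.
Qed.

(* The masses added on [high] and removed on [low] agree for every prompt. *)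
Definition swap x y : R := (pi x y +
  (e * a x * \1_(high M t) (x, y) - e * b x * \1_(low M s) (x, y)))%R.

Let swap_high x y : high M t (x, y) -> swap x y = (pi x y + e * a x)%R.
Proof.
move=> h; rewrite /swap !indicE mem_set// memNset; first by rewrite mulr0 mulr1 subr0.
by move=> l; exact: (low_high_disjoint M0 st l h).
Qed.

Let swap_low x y : low M s (x, y) -> swap x y = (pi x y - e * b x)%R.
Proof.
move=> l; rewrite /swap !indicE (mem_set l) memNset.
  by rewrite mulr0 mulr1 sub0r.
by move=> h; exact: (low_high_disjoint M0 st l h).
Qed.

Let swap_out x y : ~ high M t (x, y) -> ~ low M s (x, y) -> swap x y = pi x y.
Proof.
by move=> h l; rewrite /swap !indicE !memNset// !mulr0 subrr addr0.
Qed.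

Let swap_ge0 x y : (0 <= swap x y)%R.
Proof.
have [_ pi0 _] := piP.
have [h|h] := pselect (high M t (x, y)); first by rewrite swap_high// addr_ge0.
have [l|l] := pselect (low M s (x, y)); last by rewrite swap_out.
rewrite swap_low//; move: l => /and5P[_ _ _ /= pM _].
rewrite subr_ge0 (le_trans _ pM)// -(ler_pM2r M0) mulVf ?gt_eqF//.
by have := d_half; have := ebM x; lra.
Qed.

Let indic_xsection (A : set (X * Y)) x y :
  \1_A (x, y) = \1_(xsection A x) y :> R.
Proof. by rewrite !indicE mem_xsection. Qed.

Let mlow x : measurable (xsection (low M s) x).
Proof. by apply: measurable_xsection; exact: measurable_low. Qed.

Let mhigh x : measurable (xsection (high M t) x).
Proof. by apply: measurable_xsection; exact: measurable_high. Qed.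

Let low_oo x : mu (xsection (low M s) x) < +oo.
Proof. by rewrite (le_lt_trans (mu_low x)) ?ltry. Qed.

Let high_oo x : mu (xsection (high M t) x) < +oo.
Proof. by rewrite (le_lt_trans (mu_high x)) ?ltry. Qed.

Lemma swap_policy : is_policy mu swap.
Proof.
have [_ pi0 pi1] := piP; split => //.
  apply: measurable_funD => //.
  apply: measurable_funB; apply: measurable_funM.
  - apply: measurable_funM => //.
    exact: (measurableT_comp ma measurable_fst).
  - under eq_fun do rewrite -surjective_pairing.
    by apply: measurable_indic; exact: measurable_high.
  - apply: measurable_funM => //.
    exact: (measurableT_comp mb measurable_fst).
  - under eq_fun do rewrite -surjective_pairing.
    by apply: measurable_indic; exact: measurable_low.
move=> x; have [ih Eh] := integral_indicB (e * a x) (e * b x)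
  (mhigh x) (mlow x) (high_oo x) (low_oo x).
under eq_integral do rewrite /swap EFinD !indic_xsection.
rewrite integralD//; last first.
  apply: fin_num_integrable; last by rewrite pi1.
  by apply/measurable_EFinP; exact: measurable_section.
rewrite pi1 Eh -/(a x) -/(b x).
have -> : (e * a x * b x - e * b x * a x = 0)%R by ring.
by rewrite adde0.
Qed.

Let payoff_swap x y :
  (e * a x * (t - beta * d - beta) * \1_(high M t) (x, y) -
   e * b x * (s + 2 * (beta * d) - beta) * \1_(low M s) (x, y) <=
   payoff beta (r x y) (ref x y) (swap x y) -
   payoff beta (r x y) (ref x y) (pi x y))%R.
Proof.
have [h|h] := pselect (high M t (x, y)).
  rewrite swap_high// !indicE mem_set// memNset; last first.
    by move=> l; exact: (low_high_disjoint M0 st l h).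
  rewrite mulr1 mulr0 subr0.
  move: h => /and4P[/= v1 v2 rM pP].
  apply: (@payoff_increase _ _ _ _ _ _ M) => //.
  move: pP => /orP[/and3P[]|/andP[/eqP]]; first by left.
  by right; split => //; exact: dhigh.
have [l|l] := pselect (low M s (x, y)); last first.
  by rewrite swap_out// !indicE !memNset// !mulr0 !subrr.
rewrite swap_low// !indicE memNset// (mem_set l) mulr1 mulr0 sub0r -mulNr.
move: l => /and5P[/= v1 v2 rM p1 /andP[p2 ps]].
exact: (@payoff_decrease _ _ _ _ _ _ M).
Qed.

Lemma score_swap x : score mu r ref beta pi x \is a fin_num ->
  score mu r ref beta pi x +
    (e * (t - s - 3 * (beta * d)) * (a x * b x))%:E <=
  score mu r ref beta swap x.
Proof.
move=> pifin; have [_ pi0 _] := piP; have [_ ref0 _] := refP.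
pose B := xsection (high M t) x `|` xsection (low M s) x.
have BE y : B y <-> high M t (x, y) \/ low M s (x, y).
  by split=> -[/xsectionP h|/xsectionP h]; [left|right|left|right].
have Bbound y : B y -> [/\ M^-1 <= ref x y <= M, `|r x y| <= M,
    0 <= pi x y <= M + 1, 0 <= swap x y <= M + 1 &
    `|swap x y - pi x y| <= M^-1]%R.
  have dM k : (k * M <= d -> k <= M^-1)%R.
    by move=> kM; rewrite -(ler_pM2r M0) mulVf ?gt_eqF//; have := d_half; lra.
  have M11 : (M^-1 <= 1)%R by rewrite invf_le1.
  move=> /BE[h|l].
    rewrite (swap_high h); move: h => /and4P[/= v1 v2 rM pP].
    have pM : (pi x y <= M)%R.
      by move: pP => /orP[/and3P[]//|/andP[/eqP -> _]]; exact: ltW.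
    have := dM _ (eaM x); have := ea_ge0 x; have := pi0 x y => p0 k0 k1; have := M1.
    split; rewrite ?v1 ?v2 ?p0//=; try lra.
    by rewrite addrAC subrr add0r ger0_norm.
  have := swap_ge0 x y; rewrite (swap_low l); move: l => /and5P[/= v1 v2 rM p1 /andP[p2 ps]].
  have := dM _ (ebM x); have := eb_ge0 x; have := pi0 x y => p0 k0 k1 q0; have := M1.
  split; rewrite ?v1 ?v2 ?p0 ?q0//=; try lra.
  by rewrite addrAC subrr add0r normrN ger0_norm.
have C1 : (1 <= (M + 1) ^+ 2 * M + M)%R.
  have : (0 <= (M + 1) ^+ 2 * M)%R by rewrite mulr_ge0 ?sqr_ge0// ltW.
  have := M1; lra.
have mB : measurable B by exact: measurableU.
have Boo : mu B < +oo.
  apply: le_lt_trans (measureU2 _ (mhigh x) (mlow x)) _.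
  exact: (lte_add_pinfty (high_oo x) (low_oo x)).
have offB y : ~ B y -> swap x y = pi x y.
  by move=> nB; apply: swap_out => ?; apply: nB; apply/BE; [left|right].
have refB y : B y -> (0 < ref x y)%R.
  by move=> /Bbound[/andP[v1 _] _ _ _ _]; rewrite (lt_le_trans _ v1) ?invr_gt0.
have [||||ig ->] := @scoreD _ _ _ _ _ mu r ref beta mr refP pi swap x B
  ((M + 1) ^+ 2 * M + M)%R piP swap_policy mB Boo offB refB.
- move=> y /Bbound[_ rM _ _ k]; apply: le_trans C1.
  rewrite normrM -(mulVf (lt0r_neq0 M0)); exact: ler_pM.
- by move=> y /Bbound[v _ p _ _]; exact: entropy_bound.
- by move=> y /Bbound[v _ _ p _]; exact: entropy_bound.
- by [].
have [il El] := integral_indicB (e * a x * (t - beta * d - beta))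
  (e * b x * (s + 2 * (beta * d) - beta))
  (mhigh x) (mlow x) (high_oo x) (low_oo x).
rewrite leeD2lE//.
apply: (@le_trans _ _ (\int[mu]_y (e * a x * (t - beta * d - beta) *
    \1_(xsection (high M t) x) y - e * b x * (s + 2 * (beta * d) - beta) *
    \1_(xsection (low M s) x) y)%:E)).
  by rewrite El lee_fin -/(a x) -/(b x); lra.
apply: le_integral => // y _.
by rewrite lee_fin -!indic_xsection payoff_swap.
Qed.

Lemma ae_low_or_high_step (rho : probability X R) :
  (objective mu rho r beta ref swap <= objective mu rho r beta ref pi) ->
  objective mu rho r beta ref pi \is a fin_num ->
  (3 * (beta * d) < t - s)%R ->
  {ae rho, forall x, mu (xsection (low M s) x) = 0 \/
                     mu (xsection (high M t) x) = 0}.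
Proof.
move=> opt fin gap; pose k := (e * (t - s - 3 * (beta * d)))%R.
have k0 : (0 < k)%R by rewrite mulr_gt0// subr_gt0.
have mscore := measurable_score beta mr refP piP.
have iscore := fin_num_integrable mscore fin.
pose w x := (k * (a x * b x))%R.
have w0 x : (0 <= w x)%R by apply: mulr_ge0; [exact: ltW|exact: mulr_ge0].
have mw : measurable_fun setT (EFin \o w).
  by apply/measurable_EFinP; do 2! apply: measurable_funM => //.
have iw : rho.-integrable setT (EFin \o w).
  apply: (@le_integrable _ _ _ _ _ measurableT _ (cst (k * (M * M))%:E)) => //.
    move=> x _ /=; rewrite lee_fin (ger0_norm (w0 x)) ger0_norm; last first.
      by rewrite mulr_ge0 ?(ltW k0)// mulr_ge0 ?(ltW M0).
    rewrite ler_wpM2l ?(ltW k0)//.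
    by rewrite ler_pM// -lee_fin ?aE ?bE.
  exact: finite_measure_integrable_cst.
have /ae_eq_integral_abs : \int[rho]_x `|(w x)%:E| = 0.
  under eq_integral do rewrite gee0_abs ?lee_fin//.
  apply/eqP; rewrite eq_le integral_ge0 ?andbT; last by move=> x _; rewrite lee_fin.
  rewrite -(@leeD2lE _ (\int[rho]_x score mu r ref beta pi x))// adde0.
  apply: le_trans opt; rewrite -integralD//.
  apply: ae_le_integral.
  - exact: emeasurable_funD.
  - exact: (measurable_score beta mr refP swap_policy).
  - apply: filterS (integrable_ae measurableT iscore) => x /(_ I).
    exact: score_swap.
move=> /(_ measurableT mw); apply: filterS => x /(_ I)[/eqP].
rewrite mulf_eq0 (gt_eqF k0) orFb mulf_eq0 => /orP[]/eqP ab0; [left|right].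
  by rewrite -aE ab0.
by rewrite -bE ab0.
Qed.

End swap.

Lemma ae_low_or_high (rho : probability X R) M s t : (1 <= M)%R -> (s < t)%R ->
  (forall q, is_policy mu q ->
    objective mu rho r beta ref q <= objective mu rho r beta ref pi) ->
  objective mu rho r beta ref pi \is a fin_num ->
  {ae rho, forall x, mu (xsection (low M s) x) = 0 \/
                     mu (xsection (high M t) x) = 0}.
Proof.
move=> M1 st opt fin.
have M0 : (0 < M)%R := lt_le_trans ltr01 M1.
have [d [d0 d2' dgap dhigh]] := small_step M beta_ge0 st.
have e0 : (0 < d / (M * M))%R by rewrite divr_gt0 ?mulr_gt0.
have eM : (d / (M * M) * M * M = d)%R by field; rewrite gt_eqF.
have policy := swap_policy M1 st d2' e0 eM.
exact: (ae_low_or_high_step M1 st d0 d2' dhigh e0 eM (opt _ policy) fin dgap).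
Qed.

End perturbation.

Lemma ae_forall_countable d (T : sigmaRingType d) (R : realType)
    (mu : {measure set T -> \bar R}) (I : countType) (P : I -> T -> Prop) :
  (forall i, {ae mu, forall x, P i x}) -> {ae mu, forall x, forall i, P i x}.
Proof.
move=> aeP.
have : {ae mu, forall x, forall n, if unpickle n is Some i then P i x else True}.
  apply: ae_foralln => n; case: (unpickle n) => [i|]; first exact: aeP.
  exact: aeW.
by apply: filterS => x Px i; have := Px (pickle i); rewrite pickleK.
Qed.

Lemma ae_notin_null d (T : measurableType d) (R : realType)
    (mu : {measure set T -> \bar R}) (A : set T) :
  measurable A -> {ae mu, forall y, mu A = 0 -> ~ A y}.
Proof.
move=> mA; have [A0|An0] := pselect (mu A = 0); last exact: aeW.
exists A; split => // y /=; apply: contra_notP => nAy _.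
exact: nAy.
Qed.

Section constancy.
Context d1 d2 (X : measurableType d1) (Y : measurableType d2) (R : realType).
Variable mu : {sigma_finite_measure set Y -> \bar R}.
Variables (r ref pi : X -> Y -> R) (beta : R).
Hypothesis mr : measurable_fun [set: X * Y] (fun z => r z.1 z.2).
Hypothesis beta_ge0 : (0 <= beta)%R.
Hypothesis refP : is_policy mu ref.
Hypothesis piP : is_policy mu pi.

Let bounds x y : (0 < ref x y)%R -> exists n : nat, forall m : nat, (n <= m)%N ->
  [/\ m.+1%:R^-1 <= ref x y, ref x y <= m.+1%:R, `|r x y| <= m.+1%:R,
     pi x y <= m.+1%:R & (0 < pi x y -> m.+1%:R^-1 <= pi x y)]%R.
Proof.
move=> v0; have [_ pi0 _] := piP.
pose K := ((ref x y)^-1 + ref x y + `|r x y| + pi x y + (pi x y)^-1)%R.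
have vi0 : (0 < (ref x y)^-1)%R by rewrite invr_gt0.
have pi0' := pi0 x y.
have pii0 : (0 <= (pi x y)^-1)%R by rewrite invr_ge0.
have r0 := normr_ge0 (r x y).
have K0 : (0 <= K)%R by rewrite /K; lra.
exists (Num.bound K) => m Km.
have : (K < m.+1%:R)%R.
  by rewrite (lt_le_trans (archi_boundP K0))// ler_nat leqW.
have m0 : (0 < m.+1%:R :> R)%R by rewrite ltr0n.
rewrite /K => KM; split; try lra.
  by rewrite invf_ple ?posrE//; lra.
by move=> p0; rewrite invf_ple ?posrE//; lra.
Qed.

Let reward x y : \bar R :=
  (r x y)%:E - beta%:E * log_ratio (pi x y) (ref x y).

Let rewardE x y : (0 < ref x y)%R -> (0 < pi x y)%R ->
  reward x y = (implicit_reward r ref pi beta x y)%:E.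
Proof.
by move=> v0 p0; rewrite /reward log_ratioE ?ltW// !gt_eqF// -EFinM -EFinB.
Qed.

Let good x y := forall i : nat * rat,
  (mu (xsection (low r ref pi beta i.1.+1%:R (ratr i.2)) x) = 0 ->
    ~ low r ref pi beta i.1.+1%:R (ratr i.2) (x, y)) /\
  (mu (xsection (high r ref pi beta i.1.+1%:R (ratr i.2)) x) = 0 ->
    ~ high r ref pi beta i.1.+1%:R (ratr i.2) (x, y)).

Let ae_good x : {ae mu, forall y, good x y}.
Proof.
apply: ae_forall_countable => i.
have ml := measurable_xsection x
  (measurable_low beta mr refP piP i.1.+1%:R (ratr i.2)).
have mh := measurable_xsection x
  (measurable_high beta mr refP piP i.1.+1%:R (ratr i.2)).
apply: filterS2 (ae_notin_null mu ml) (ae_notin_null mu mh) => y hl hh.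
by split => [/hl|/hh] n; move=> /xsectionP.
Qed.

Let reward_le x y y' :
  (forall i : nat * (rat * rat), ratr i.2.1 < ratr i.2.2 :> R ->
    mu (xsection (low r ref pi beta i.1.+1%:R (ratr i.2.1)) x) = 0 \/
    mu (xsection (high r ref pi beta i.1.+1%:R (ratr i.2.2)) x) = 0)%R ->
  good x y -> good x y' -> (0 < ref x y)%R -> (0 < ref x y')%R ->
  (0 < pi x y)%R -> (0 < pi x y')%R \/ (0 < beta)%R ->
  reward x y' <= reward x y.
Proof.
move=> H gy gy' v0 v0' p0 pb'; rewrite leNgt; apply/negP => lt.
have [_ pi0 _] := piP.
have [s [t [st ys ty']]] : exists s t : rat, [/\ ratr s < ratr t :> R,
    implicit_reward r ref pi beta x y < ratr s &
    0 < pi x y' -> ratr t < implicit_reward r ref pi beta x y']%R.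
  have [p0'|p0'] := ltP 0%R (pi x y').
    move: lt; rewrite !rewardE// lte_fin => /rat_in_itvoo[s].
    rewrite in_itv/= => /andP[ys /rat_in_itvoo[t]].
    by rewrite in_itv/= => /andP[st ty']; exists s, t.
  have /rat_in_itvoo[s] : (implicit_reward r ref pi beta x y <
    implicit_reward r ref pi beta x y + 1)%R by lra.
  rewrite in_itv/= => /andP[ys /rat_in_itvoo[t]].
  by rewrite in_itv/= => /andP[st _]; exists s, t.
have [n Hn] := bounds v0; have [n' Hn'] := bounds v0'.
have [b1 b2 b3 b4 /(_ p0) b5] := Hn _ (leq_maxl n n').
have [c1 c2 c3 c4 c5] := Hn' _ (leq_maxr n n').
have [l0|h0] := H (maxn n n', (s, t)) st.
  apply: (gy (maxn n n', s)).1 l0 _.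
  by rewrite /low/= b1 b2 b3 b4 b5.
apply: (gy' (maxn n n', t)).2 h0 _.
rewrite /high/= c1 c2 c3 c4/=.
have [p0'|] := ltP 0%R (pi x y'); first by rewrite c5// ty'.
move=> p0'; have -> : pi x y' = 0%R by apply/eqP; rewrite eq_le p0' pi0.
case: pb' => [|->]; first by rewrite ltNge p0'.
by rewrite eqxx orbT.
Qed.

Lemma ae_pi_gt0_ref_gt0 x : KL mu pi ref x \is a fin_num ->
  ~ {ae mu, forall y, (0 < ref x y)%R -> pi x y = 0%R}.
Proof.
move=> Kfin aepi; have [mref ref0 _] := refP; have [mpi pi0 pi1] := piP.
have mlr : measurable_fun setT (fun y => (pi x y)%:E * log_ratio (pi x y) (ref x y)).
  apply: emeasurable_funM.
    by apply/measurable_EFinP; exact: measurable_section.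
  by apply: measurable_log_ratio => //; exact: measurable_section.
have ilr := fin_num_integrable mlr Kfin.
have : \int[mu]_y (pi x y)%:E = \int[mu]_y (cst 0 y).
  apply: ae_eq_integral => //.
    by apply/measurable_EFinP; exact: measurable_section.
  apply: filterS2 aepi (integrable_ae measurableT ilr) => y py fy _.
  move: (fy I); have := ref0 x y; rewrite le_eqVlt => /predU1P[v0|/py -> //].
  rewrite log_ratioE// -v0 eqxx.
  have [->//|pn0] := eqVneq (pi x y) 0%R.
  by rewrite gt0_muley ?lte_fin ?lt_def ?pn0 ?pi0.
by rewrite pi1 integral0 => /eqP; rewrite onee_eq0.
Qed.

Lemma reward_constant x :
  (forall i : nat * (rat * rat), ratr i.2.1 < ratr i.2.2 :> R ->
    mu (xsection (low r ref pi beta i.1.+1%:R (ratr i.2.1)) x) = 0 \/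
    mu (xsection (high r ref pi beta i.1.+1%:R (ratr i.2.2)) x) = 0)%R ->
  score mu r ref beta pi x \is a fin_num ->
  exists c : R, {ae mu, forall y, (0 < ref x y)%R ->
    (beta = 0%R -> (0 < pi x y)%R) ->
    (r x y)%:E - beta%:E * log_ratio (pi x y) (ref x y) = c%:E}.
Proof.
move=> H sfin; have [_ pi0 _] := piP.
have [[y0 [g0 v0 p0]]|none] :=
  pselect (exists y, [/\ good x y, 0 < ref x y & 0 < pi x y]%R).
  exists (implicit_reward r ref pi beta x y0).
  apply: filterS (ae_good x) => y gy vy py; rewrite -(rewardE v0 p0) -/(reward x y).
  have pb : (0 < pi x y)%R \/ (0 < beta)%R.
    move: beta_ge0; rewrite le_eqVlt => /predU1P[b0|]; last by right.
    by left; exact: py.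
  have le0 : reward x y <= reward x y0 by exact: reward_le.
  have py0 : (0 < pi x y)%R.
    rewrite lt_def pi0 andbT; apply/eqP => pe0; move: le0.
    case: pb => [|b0]; first by rewrite pe0 ltxx.
    rewrite (rewardE v0 p0) /reward (log_ratioE (pi0 x y) (ltW vy)) pe0 eqxx.
    by rewrite mulrNy gtr0_sg// mul1e.
  apply/eqP; rewrite eq_le le0/=; apply: reward_le => //; by left.
exists 0%R.
have [b0|bn0] := eqVneq beta 0%R.
  apply: filterS (ae_good x) => y gy vy /(_ b0) py.
  by exfalso; apply: none; exists y.
exfalso; apply: (@ae_pi_gt0_ref_gt0 x); first exact: KL_fin_num sfin bn0.
apply: filterS (ae_good x) => y gy vy; apply/eqP; rewrite eq_le pi0 andbT leNgt.
by apply/negP => py; apply: none; exists y.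
Qed.

End constancy.

Theorem theorem1 (R : realType) (d1 d2 : measure_display)
    (X : measurableType d1) (Y : measurableType d2)
    (mu : {sigma_finite_measure set Y -> \bar R}) (rho : probability X R)
    (r : X -> Y -> R) (beta : R) (pi_ref pi_star : X -> Y -> R)
    (mr : measurable_fun [set: X * Y] (fun z => r z.1 z.2))
    (beta_ge0 : (0 <= beta)%R)
    (ref_policy : is_policy mu pi_ref)
    (star_optimal : is_optimal_policy mu rho r beta pi_ref pi_star)
    (star_finite : objective mu rho r beta pi_ref pi_star \is a fin_num) :
  exists c : X -> R,
    {ae rho, forall x, {ae mu, forall y,
      (0 < pi_ref x y)%R ->
      (beta = 0%R -> (0 < pi_star x y)%R) ->
      (r x y)%:E - beta%:E * log_ratio (pi_star x y) (pi_ref x y)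
      = (c x)%:E}}.
Proof.
have [pi_policy opt] := star_optimal.
pose P x c := {ae mu, forall y, (0 < pi_ref x y)%R ->
  (beta = 0%R -> (0 < pi_star x y)%R) ->
  (r x y)%:E - beta%:E * log_ratio (pi_star x y) (pi_ref x y) = c%:E}.
have /choice[c cP] x : exists c, (exists c', P x c') -> P x c.
  have [[c Pc]|nP] := pselect (exists c', P x c'); first by exists c.
  by exists 0%R.
exists c.
have Hfin : {ae rho, forall x, score mu r pi_ref beta pi_star x \is a fin_num}.
  have ms := measurable_score beta mr ref_policy pi_policy.
  have := integrable_ae measurableT (fin_num_integrable ms star_finite).
  by apply: filterS => x; apply.
have Hnull : {ae rho, forall x, forall i : nat * (rat * rat),
    (ratr i.2.1 < ratr i.2.2 :> R)%R ->
    mu (xsection (low r pi_ref pi_star beta i.1.+1%:R (ratr i.2.1)) x) = 0 \/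
    mu (xsection (high r pi_ref pi_star beta i.1.+1%:R (ratr i.2.2)) x) = 0}.
  apply: ae_forall_countable => i.
  have [st|nst] := pselect (ratr i.2.1 < ratr i.2.2 :> R)%R; last exact: aeW.
  have M1 : (1 <= i.1.+1%:R :> R)%R by rewrite ler1n.
  have := ae_low_or_high mr beta_ge0 ref_policy pi_policy M1 st opt star_finite.
  by apply: filterS.
apply: filterS2 Hfin Hnull => x fin null; apply: cP.
exact: (reward_constant mr beta_ge0 ref_policy pi_policy).
Qed.
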